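(* Let $m\ge2$ be an integer. There exist an integer $0<q<m$ coprime to $m$ and Wahl chains $\mathtt W_0,\mathtt W_1$ such that, writing $\frac mq=[x_1,\dots,x_r]$ and $\frac m{m-q}=[y_1,\dots,y_s]$ with all $x_i,y_j\ge2$, $$[5,x_1,\dots,x_r,2,y_s,\dots,y_1,5]=[\mathtt W_0,2,\mathtt W_1],$$ if and only if there is a Markov triple $(a,b,c)$ with $1<a,b<c$ and $c=m$.
   Context: A Markov triple is a positive integer solution of $x^2+y^2+z^2=3xyz$. The Hirzebruch-Jung continued fraction is $[e_1,\dots,e_r]=e_1-\cfrac1{e_2-\cfrac1{\ddots-\cfrac1{e_r}}}$; each rational number $>1$ is uniquely $[e_1,\dots,e_r]$ with all $e_i\ge2$, called its chain. A Wahl chain is the chain of $\frac{n^2}{na-1}$ for coprime integers $0<a<n$. The notation $[\mathtt W_0,2,\mathtt W_1]$ means the continued fraction of the concatenated sequence.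
   Formalization: Requiring both 1<a<c and 1<b<c is false at m=2: [5,2,2,2,5]=[W0,2,W1] with W0=[5,2], W1=[2,5]. Here ''1<a,b<c'' is taken as 1<a and b<c only (b=1 or a≥c allowed), so the right side says that m is a Markov number. *)

(* Defs.v *)
From mathcomp Require Import all_boot all_order all_algebra.

Set Implicit Arguments.
Unset Strict Implicit.
Unset Printing Implicit Defensive.

Import GRing.Theory Num.Theory.

Local Open Scope ring_scope.

(* [e_1, ..., e_r] = e_1 - 1 / [e_2, ..., e_r]. Since 0^-1 = 0 in rat, the
   starting value 0 makes the last entry contribute just e_r. When all entries
   are at least 2, every other denominator is greater than 1. *)
Definition hj_cf (s : seq nat) : rat :=
  foldr (fun (e : nat) (v : rat) => e%:R - v^-1) 0 s.

Definition is_chain_of (x : rat) (s : seq nat) : Prop :=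
  [/\ s <> [::], all (leq 2) s & hj_cf s = x].

Definition wahl_chain (s : seq nat) : Prop :=
  exists n a : nat,
    [/\ (0 < a < n)%N, coprime a n &
        is_chain_of ((n ^ 2)%:R / ((n * a)%:R - 1)) s].

Definition markov_triple (a b c : nat) : Prop :=
  [/\ (0 < a)%N, (0 < b)%N, (0 < c)%N &
      (a ^ 2 + b ^ 2 + c ^ 2 = 3 * a * b * c)%N].

(* Main.v *)
Require Import Defs.
From mathcomp Require Import all_boot all_order all_algebra.
From mathcomp Require Import zify ring.

Local Open Scope ring_scope.

Set Implicit Arguments.
Unset Strict Implicit.
Unset Printing Implicit Defensive.

Import Order.TTheory GRing.Theory Num.Theory.

(** Encode a chain [e_1, ..., e_r] by the product of the matrices
    ((e_i, -1), (1, 0)) in SL_2(Z). For entries at least 2 the product and the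
    value of the continued fraction determine each other ([hjmx_hj_cf]), so the
    equality of continued fractions is an equality of two integer matrices.

    Both matrices are explicit. For the chains x and y of m/q and m/(m-q), the
    sequence 5, x, 2, rev y, 5 has the matrix
      ((20 m^2 + m q - q^2 - 9, -(5 m^2 - m q - 1)),
       (4 m^2 + m q - 1,        - m^2)),
    by [hjmx_dual] and [mul_dual_mx]. For Wahl chains of n^2/(n a - 1) and
    n'^2/(n' a' - 1), put b = n' - a' and d = n b + n' a; then W0, 2, W1 has
    lower right entry a^2 + b^2 - a b d, and off-diagonal entries
    n' a d + n a - n' b - 1 and -(n b d + n' b - n a - 1) ([mul_wahl_mx]).

    The difference of the off-diagonal entries is 9 m^2 - 2 on one side and
    d^2 - 2 on the other, so d = 3 m, and then the lower right corner is
    precisely the Markov equation a^2 + b^2 + m^2 = 3 a b m. Together with the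
    value of one off-diagonal entry, these conditions are equivalent to the
    equality of the matrices ([dual_eq_wahl]).

    So a solution yields the Markov triple (a, b, m). Conversely, a Markov
    number m is the largest entry of a Markov triple (a, b, m) ([markov_max]);
    with q = 3 a / b modulo m, the remaining conditions are linear in n and n'
    and have a unique solution, which is integral and satisfies a < n, b < n'
    and the coprimality required of Wahl chains ([markov_wahl]). *)

(** * Integer matrices of continued fractions *)

Definition mx2 (a b c d : int) : 'M[int]_2 :=
  \matrix_(i, j) if i == 0 then (if j == 0 then a else b)
                 else (if j == 0 then c else d).

Lemma mul_mx2 a b c d a' b' c' d' :
  mx2 a b c d * mx2 a' b' c' d' =
  mx2 (a * a' + b * c') (a * b' + b * d') (c * a' + d * c') (c * b' + d * d').
Proof.
apply/matrixP=> i j; rewrite !mxE !big_ord_recl big_ord0 !mxE /= addr0.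
by case: (i == 0); case: (j == 0).
Qed.

Lemma mx2_inj a b c d a' b' c' d' :
  mx2 a b c d = mx2 a' b' c' d' -> [/\ a = a', b = b', c = c' & d = d'].
Proof.
move=> e; split; [have := congr1 (fun M : 'M_2 => M 0 0) e
  | have := congr1 (fun M : 'M_2 => M 0 1) e
  | have := congr1 (fun M : 'M_2 => M 1 0) e
  | have := congr1 (fun M : 'M_2 => M 1 1) e]; by rewrite !mxE.
Qed.

Lemma mx2E (M : 'M[int]_2) : M = mx2 (M 0 0) (M 0 1) (M 1 0) (M 1 1).
Proof.
have ord2 (i : 'I_2) : i = 0 \/ i = 1.
  by case: i => -[|[|//]] ?; [left | right]; apply: val_inj.
by apply/matrixP=> i j; rewrite !mxE; case: (ord2 i) (ord2 j) => -> [] ->.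
Qed.

Lemma mx2_1 : mx2 1 0 0 1 = 1.
Proof. by rewrite [RHS]mx2E !mxE. Qed.

(** The Moebius map of this matrix sends z to [e_1, ..., e_r - 1/z]; its first
    column is the numerator and denominator of [e_1, ..., e_r]. *)
Definition hjmx (s : seq nat) : 'M[int]_2 :=
  \prod_(e <- s) mx2 e%:Z (-1) 1 0.

Lemma hjmx_nil : hjmx [::] = mx2 1 0 0 1.
Proof. by rewrite /hjmx big_nil mx2_1. Qed.

Lemma hjmx1 e : hjmx [:: e] = mx2 e%:Z (-1) 1 0.
Proof. by rewrite /hjmx big_seq1. Qed.

Lemma hjmx_cat s t : hjmx (s ++ t) = hjmx s * hjmx t.
Proof. by rewrite /hjmx big_cat. Qed.

(** Each factor M equals D M^T D with D = diag(1, -1), so reversing the product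
    transposes it up to conjugation by D. *)
Lemma hjmx_rev s a b c d :
  hjmx s = mx2 a b c d -> hjmx (rev s) = mx2 a (- c) (- b) d.
Proof.
elim: s a b c d => [|e s IH] a b c d.
  by rewrite /rev /= hjmx_nil => /mx2_inj[<- <- <- <-]; rewrite oppr0.
move: (mx2E (hjmx s)); set a' := _ 0 0; set b' := _ 0 1; set c' := _ 1 0.
set d' := hjmx s 1 1 => es.
rewrite -cat1s rev_cat !hjmx_cat (IH _ _ _ _ es) es hjmx1 !mul_mx2.
by case/mx2_inj => <- <- <- <-; congr mx2; ring.
Qed.

(** The first column being reduced and the second column lying in the range
    0 <= r < p are what makes the matrix recoverable from the fraction. The
    empty sequence is covered because hj_cf [::] = 0 = 1 / 0. *)
Lemma hjmxP s : all (leq 2) s -> exists p r q t : int,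
  [/\ hjmx s = mx2 p (- r) q (- t), q * r = 1 + p * t,
      0 <= q < p, 0 <= r < p & hj_cf s = p%:~R / q%:~R].
Proof.
elim: s => [|e s IH] /=.
  by move=> _; exists 1, 0, 0, (-1); rewrite hjmx_nil.
case/andP=> e2 /IH [p [r [q [t [es det /andP[q0 qp] /andP[r0 rp] ev]]]]].
exists (e%:Z * p - q), (e%:Z * r - t), p, r.
have tr : t < r by nia.
have pp : p < e%:Z * p - q by nia.
split.
- by rewrite -cat1s hjmx_cat es hjmx1 mul_mx2; congr mx2; ring.
- by nia.
- by lia.
- have e2r : 2 * r <= e%:Z * r by nia.
  apply/andP; split; first by lia.
  nia.
- rewrite /hj_cf /= -/(hj_cf s) ev invf_div intrB intrM -pmulrn.
  have pn0 : p%:~R != 0 :> rat by rewrite intr_eq0; lia.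
  by field.
Qed.

(** A reduced fraction p / q determines p and q up to a common sign; then r is
    the inverse of q modulo p in [0, p), and t is given by the determinant. *)
Lemma unimod_uniq (p r q t p' r' q' t' : int) :
  q * r = 1 + p * t -> q' * r' = 1 + p' * t' -> 0 < p -> 0 < p' ->
  0 <= r < p -> 0 <= r' < p' -> p * q' = p' * q ->
  [/\ p = p', r = r', q = q' & t = t'].
Proof.
move=> det det' p0 p0' rp rp' cross.
have d1 : p = p' * (q * r' - p * t').
  have := congr1 ( *%R p) det'; have := congr1 ( *%R r') cross; lia.
have d2 : p' = p * (q' * r - p' * t).
  have := congr1 ( *%R p') det; have := congr1 ( *%R r) cross; lia.
have epp : p = p'.
  have [k1 e1] : exists k, p = p' * k by exists (q * r' - p * t').
  have [k2 e2] : exists k, p' = p * k by exists (q' * r - p' * t).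
  have k10 : 0 < k1 by nia.
  have k20 : 0 < k2 by nia.
  nia.
rewrite -epp in det' rp' cross *.
have pn0 : p != 0 by lia.
have eqq : q = q' by apply: (mulfI pn0).
rewrite -eqq in det' *.
have [k d3] : exists k, r - r' = p * k.
  exists (r' * t - r * t').
  have := congr1 ( *%R r) det'; have := congr1 ( *%R r') det; lia.
have k0 : k = 0.
  have lt1 : r - r' < p by lia.
  have lt2 : - p < r - r' by lia.
  rewrite d3 in lt1 lt2; clear -lt1 lt2 p0; nia.
have err : r = r' by move: d3; rewrite k0; lia.
by split => //; apply: (mulfI pn0); rewrite -err in det'; lia.
Qed.

(** Euclidean division with remainder taken from above: p = e q - r where
    e = ceil(p/q) is at least 2 because q < p, and 0 <= r < q. *)
Lemma hj_chain_exists (p q : nat) : (0 < q < p)%N ->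
  exists s, is_chain_of (p%:R / q%:R) s.
Proof.
elim/ltn_ind: q p => q IH p /andP[q0 qp].
case: (posnP (p %% q)) => [pq0 | pq0].
  have pE : p = (p %/ q * q)%N by rewrite [LHS](divn_eq p q) pq0 addn0.
  exists [:: (p %/ q)%N]; split => //=; first by rewrite andbT; nia.
  rewrite /hj_cf /= invr0 subr0 {2}pE natrM mulfK // pnatr_eq0; lia.
have rq : (p %% q < q)%N by rewrite ltn_mod.
have [] := IH (q - p %% q)%N _ q; [lia | lia | move=> s [s0 s2 es]].
exists ((p %/ q).+1 :: s); split => //=.
  by rewrite s2 andbT ltnS divn_gt0 // ltnW.
rewrite /hj_cf /= -/(hj_cf s) es invf_div.
have -> : p%:R = (p %/ q).+1%:R * q%:R - (q - p %% q)%:R :> rat.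
  rewrite natrB ?(ltnW rq) // [in LHS](divn_eq p q) natrD natrM -natr1.
  ring.
field; rewrite pnatr_eq0; lia.
Qed.

(** Zero denominators are harmless: positive numerators force both denominators
    to vanish together. *)
Lemma eq_frac_cross (p q p' q' : int) : 0 < p -> 0 < p' ->
  p%:~R / q%:~R = p'%:~R / q'%:~R :> rat -> p * q' = p' * q.
Proof.
move=> p0 p'0; have [-> | qn0] := eqVneq q 0; have [-> | q'n0] := eqVneq q' 0.
- by rewrite !mulr0.
- rewrite invr0 mulr0 => /esym/eqP; rewrite mulf_eq0 invr_eq0 !intr_eq0; lia.
- rewrite invr0 mulr0 => /eqP; rewrite mulf_eq0 invr_eq0 !intr_eq0; lia.
by move=> /eqP; rewrite eqr_div ?intr_eq0 // -!intrM eqr_int => /eqP.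
Qed.

Lemma hjmx_chain s (p r q t : int) :
  all (leq 2) s -> hj_cf s = p%:~R / q%:~R -> q * r = 1 + p * t ->
  0 <= r < p -> hjmx s = mx2 p (- r) q (- t).
Proof.
move=> /hjmxP[p' [r' [q' [t' [-> det' qp' rp' ->]]]]] ev det rp.
have [p0 p'0] : 0 < p /\ 0 < p' by lia.
have cross := eq_frac_cross p'0 p0 ev.
by case: (unimod_uniq det' det p'0 p0 rp' rp cross) => -> -> -> ->.
Qed.

(** This stands in for the uniqueness of chains: an equality of continued
    fractions yields four integer equations instead of one rational equation. *)
Lemma hjmx_hj_cf s1 s2 : all (leq 2) s1 -> all (leq 2) s2 ->
  hj_cf s1 = hj_cf s2 <-> hjmx s1 = hjmx s2.
Proof.
move=> s1P s2P; split=> [|].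
  case: (hjmxP s2P) => [p [r [q [t [-> det _ rp ->]]]]] ev.
  exact: hjmx_chain.
case: (hjmxP s1P) (hjmxP s2P) => [p [r [q [t [-> _ _ _ ->]]]]].
by case=> [p' [r' [q' [t' [-> _ _ _ ->]]]]] /mx2_inj[-> _ -> _].
Qed.

(** * The matrices of the two concatenations *)

Lemma solve_mod (b c m : int) : 0 < m -> coprimez b m ->
  exists q s, b * q = c + m * s /\ 0 <= q < m.
Proof.
move=> m0 /coprimezP[[u v] /= uv].
exists ((c * u) %% m)%Z, (- c * v - b * (c * u %/ m)%Z); split; last first.
  by rewrite modz_ge0 ?ltz_mod //; lia.
have := congr1 ( *%R b) (divz_eq (c * u) m); have := congr1 ( *%R c) uv.
by move: (_ %% _)%Z (_ %/ _)%Z => w k; lia.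
Qed.

(** Dual chains x and y satisfy [x, 1, rev y] = 0, and in fact the product of
    matrices for (x, 1, rev y) is ((0, -1), (1, -1)), whatever m and q are.
    Turning the 1 into a 2 adds the rank one matrix made of the first column
    (m, q) of the matrix of x and the first row (m, q - m) of that of rev y. *)
Lemma hjmx_dual (m q : int) x y : 1 < m -> 0 < q < m -> coprimez q m ->
  all (leq 2) x -> hj_cf x = m%:~R / q%:~R ->
  all (leq 2) y -> hj_cf y = m%:~R / (m - q)%:~R ->
  hjmx (x ++ [:: 2%N] ++ rev y) =
  mx2 (m ^+ 2) (- (m * (m - q) + 1)) (m * q + 1) (- (q * (m - q) + 1)).
Proof.
move=> m1 qm cop xP ex yP ey.
have [r [t [det rm]]] := solve_mod 1 (ltW m1 : 0 < m) cop.
have r0 : r != 0.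
  by apply/eqP => r0; move: det; rewrite r0; case: (leP 0 t) => ?; nia.
rewrite !hjmx_cat hjmx1 (hjmx_chain xP ex det rm).
have det' : (m - q) * (m - r) = 1 + m * (m - q - r + t) by lia.
rewrite (hjmx_rev (hjmx_chain yP ey det' _)); last by lia.
rewrite !mul_mx2; congr mx2; lia.
Qed.

(** The matrix of the Wahl chain of n^2 / (n a - 1): it has determinant 1, and
    its upper right entry shows that the reversed chain is the Wahl chain
    attached to n - a. *)
Definition wahl_mx (n a : int) : 'M[int]_2 :=
  mx2 (n ^+ 2) (- (n * (n - a) - 1)) (n * a - 1) (- (a * (n - a) - 1)).

Lemma hjmx_wahl (n a : nat) s : (0 < a < n)%N ->
  is_chain_of ((n ^ 2)%:R / ((n * a)%:R - 1)) s ->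
  hjmx s = wahl_mx n%:Z a%:Z.
Proof.
move=> an [_ sP ev]; apply: hjmx_chain => //; [|lia|nia].
by rewrite ev intrB intrM -!pmulrn natrM natrX.
Qed.

Lemma wahl_fraction_chain (n a : nat) : (0 < a < n)%N ->
  exists s, is_chain_of ((n ^ 2)%:R / ((n * a)%:R - 1)) s.
Proof.
move=> an; have [|s sP] := @hj_chain_exists (n ^ 2) (n * a).-1; first nia.
by exists s; rewrite -subn1 natrB in sP; last by nia.
Qed.

Lemma mul_dual_mx (m q : int) :
  mx2 5 (-1) 1 0 *
  mx2 (m ^+ 2) (- (m * (m - q) + 1)) (m * q + 1) (- (q * (m - q) + 1)) *
  mx2 5 (-1) 1 0 =
  mx2 (20 * m ^+ 2 + m * q - q ^+ 2 - 9) (- (5 * m ^+ 2 - m * q - 1))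
      (4 * m ^+ 2 + m * q - 1) (- m ^+ 2).
Proof. by rewrite !mul_mx2; congr mx2; ring. Qed.

Lemma mul_wahl_mx (n a n' b : int) (d := n * b + n' * a) :
  wahl_mx n a * mx2 2 (-1) 1 0 * wahl_mx n' (n' - b) =
  mx2 (n ^+ 2 + n' ^+ 2 + n * n' * d) (- (n * b * d + n' * b - n * a - 1))
      (n' * a * d + n * a - n' * b - 1) (- (a * b * d - a ^+ 2 - b ^+ 2)).
Proof. by rewrite !mul_mx2 /d; congr mx2; ring. Qed.

(** The Markov equation appears here. With d = n b + n' a, the lower left
    entry minus the upper right one is 9 m^2 - 2 on the left and d^2 - 2 on the
    right, so d = 3 m; the lower right entries then say that (a, b, m)
    satisfies the Markov equation. Conversely the three conditions match every
    entry but the upper left one, which the determinant 1 forces as m is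
    nonzero. *)
Lemma dual_eq_wahl (m q n a n' b : int) :
  0 < m -> 0 < n -> 0 < a -> 0 < n' -> 0 < b ->
  mx2 5 (-1) 1 0 *
  mx2 (m ^+ 2) (- (m * (m - q) + 1)) (m * q + 1) (- (q * (m - q) + 1)) *
  mx2 5 (-1) 1 0 = wahl_mx n a * mx2 2 (-1) 1 0 * wahl_mx n' (n' - b) <->
  [/\ n * b + n' * a = 3 * m, a ^+ 2 + b ^+ 2 + m ^+ 2 = 3 * a * b * m &
      4 * m ^+ 2 + m * q = 3 * m * (n' * a) + n * a - n' * b].
Proof.
move=> m0 n0 a0 n'0 b0; rewrite mul_dual_mx mul_wahl_mx; set d := n * b + n' * a.
split=> [/mx2_inj[_ e2 e3 e4] | [ed mar e3]].
  have ed : d = 3 * m.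
    have d0 : 0 < d by rewrite addr_gt0 // mulr_gt0.
    have: d ^+ 2 = (3 * m) ^+ 2 by rewrite /d in e2 e3 *; lia.
    by move/eqP; rewrite eqrXn2 ?(ltW d0) //; [move/eqP | lia].
  by rewrite ed in e3 e4; split => //; lia.
have e2 : n * b * (3 * m) + n' * b - n * a - 1 = 5 * m ^+ 2 - m * q - 1.
  have := congr1 ( *%R (3 * m)) ed; rewrite /d; lia.
rewrite ed; congr mx2; try lia.
have m2n0 : m ^+ 2 != 0 by rewrite expf_neq0; lia.
apply: (mulfI m2n0).
have -> : m ^+ 2 * (20 * m ^+ 2 + m * q - q ^+ 2 - 9) =
    (5 * m ^+ 2 - m * q - 1) * (4 * m ^+ 2 + m * q - 1) - 1 by ring.
have -> : 4 * m ^+ 2 + m * q - 1 = n' * a * d + n * a - n' * b - 1.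
  by rewrite ed; lia.
rewrite -e2 -ed.
have -> : m ^+ 2 = a * b * d - a ^+ 2 - b ^+ 2 by rewrite ed; lia.
by rewrite /d; ring.
Qed.

(** The parameter a' of the second Wahl chain enters through n' - a', the
    parameter of the reversed chain; this makes the two sides symmetric. *)
Lemma dual_eq_wahl_chains (m q n a n' a' : nat) x y W0 W1 :
  (1 < m)%N -> (0 < q < m)%N -> coprime q m ->
  (0 < a < n)%N -> (0 < a' < n')%N ->
  is_chain_of (m%:R / q%:R) x -> is_chain_of (m%:R / (m%:R - q%:R)) y ->
  is_chain_of ((n ^ 2)%:R / ((n * a)%:R - 1)) W0 ->
  is_chain_of ((n' ^ 2)%:R / ((n' * a')%:R - 1)) W1 ->
  let b := n'%:Z - a'%:Z in
  hj_cf ([:: 5%N] ++ x ++ [:: 2%N] ++ rev y ++ [:: 5%N]) =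
    hj_cf (W0 ++ [:: 2%N] ++ W1) <->
  [/\ n%:Z * b + n'%:Z * a = 3 * m%:Z,
      a%:Z ^+ 2 + b ^+ 2 + m%:Z ^+ 2 = 3 * a%:Z * b * m%:Z &
      4 * m%:Z ^+ 2 + m%:Z * q = 3 * m%:Z * (n'%:Z * a) + n%:Z * a - n'%:Z * b].
Proof.
move=> m1 qm cop an an' [_ xP ex] [_ yP ey] W0c W1c b.
have [[_ W0P _] [_ W1P _]] := (W0c, W1c).
have LP : all (leq 2) ([:: 5%N] ++ x ++ [:: 2%N] ++ rev y ++ [:: 5%N]).
  by rewrite !all_cat /= all_rev xP yP.
have RP : all (leq 2) (W0 ++ [:: 2%N] ++ W1) by rewrite !all_cat /= W0P W1P.
rewrite (hjmx_hj_cf LP RP).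
have -> : hjmx ([:: 5%N] ++ x ++ [:: 2%N] ++ rev y ++ [:: 5%N]) =
    hjmx [:: 5%N] * hjmx (x ++ [:: 2%N] ++ rev y) * hjmx [:: 5%N].
  by rewrite !hjmx_cat !mulrA.
have -> : hjmx (W0 ++ [:: 2%N] ++ W1) = hjmx W0 * hjmx [:: 2%N] * hjmx W1.
  by rewrite !hjmx_cat mulrA.
have m1z : 1 < m%:Z by lia.
have qmz : 0 < q%:Z < m%:Z by lia.
have eyz : hj_cf y = m%:Z%:~R / (m%:Z - q%:Z)%:~R by rewrite ey intrB -!pmulrn.
rewrite (hjmx_dual m1z qmz (cop : coprimez q m) xP ex yP eyz).
rewrite (hjmx_wahl an W0c) (hjmx_wahl an' W1c) !hjmx1.
have -> : a'%:Z = n'%:Z - b by rewrite /b; ring.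
by apply: dual_eq_wahl; lia.
Qed.

(** * Markov numbers *)

(** Vieta descent: every Markov triple is reached from (1, 1, 1) by mutations
    (a, b, c) -> (3bc - a, b, c) that create a largest entry. *)
Lemma markov_ind (P : nat -> nat -> nat -> Prop) :
  P 1 1 1 ->
  (forall a b c, P a b c -> P b a c) ->
  (forall a b c, P a b c -> P a c b) ->
  (forall a b c, markov_triple a b c -> P a b c ->
     (a <= 3 * b * c)%N -> (b <= 3 * b * c - a)%N -> (c <= 3 * b * c - a)%N ->
     P (3 * b * c - a)%N b c) ->
  forall a b c, markov_triple a b c -> P a b c.
Proof.
move=> P1 sw12 sw23 step a b c.
have [n] := ubnP (a + b + c)%N; elim: n a b c => // n IH.
suff sorted a b c : (a + b + c < n.+1)%N -> markov_triple a b c ->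
    (b <= a)%N -> (c <= b)%N -> P a b c.
  move=> a b c lt_n mt.
  have mt' x y z : (x + y + z = a + b + c)%N ->
    (x ^ 2 + y ^ 2 + z ^ 2 = a ^ 2 + b ^ 2 + c ^ 2)%N ->
    (x * y * z = a * b * c)%N -> (0 < x)%N -> (0 < y)%N -> (0 < z)%N ->
    (y <= x)%N -> (z <= y)%N -> P x y z.
    move=> e1 e2 e3 x0 y0 z0 yx zy; apply: sorted => //; first by lia.
    by case: mt => _ _ _ e; split => //; lia.
  case: (mt) => a0 b0 c0 _.
  case: (leqP a b) => ab; case: (leqP a c) => ac; case: (leqP b c) => bc.
  - apply/sw12/sw23/sw12/mt' => //; lia.
  - apply/sw12/sw23/mt' => //; lia.
  - lia.
  - apply/sw12/mt' => //; lia.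
  - apply/sw23/sw12/mt' => //; lia.
  - lia.
  - apply/sw23/mt' => //; lia.
  - apply/mt' => //; lia.
move=> lt_n [a0 b0 c0 e] ba cb.
have [eab | nab] := eqVneq a b.
  rewrite {}eab in e *; have [-> ->] : b = 1%N /\ c = 1%N by nia.
  exact: P1.
(* As a polynomial in its largest entry, the Markov equation has roots a and
   a'; its value 2 b^2 + c^2 - 3 b^2 c at b is not positive, so a' <= b < a. *)
have lt_ba : (b < a)%N by lia.
have le_a : (a <= 3 * b * c)%N by nia.
set a' := (3 * b * c - a)%N; have ea : (a + a' = 3 * b * c)%N by lia.
have eaa : (a * a' = b ^ 2 + c ^ 2)%N by nia.
have a'0 : (0 < a')%N by nia.
have a'b : (a' <= b)%N by nia.
have mt' : markov_triple a' b c by split => //; nia.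
have -> : a = (3 * b * c - a')%N by lia.
apply: step; rewrite //; try lia.
by apply: IH => //; lia.
Qed.

Lemma coprime_dvd_subr d x k :
  (d %| k -> x <= k -> coprime d x -> coprime d (k - x))%N.
Proof.
move=> dk xk; rewrite /coprime -!dvdn1; apply: dvdn_trans.
rewrite dvdn_gcd dvdn_gcdl /= -(dvdn_subr xk) ?dvdn_gcdr //.
by rewrite (dvdn_trans _ dk) ?dvdn_gcdl.
Qed.

(** All six conditions survive a mutation, since 3bc - a is congruent to - a
    modulo b, c and 3. *)
Lemma markov_coprime a b c : markov_triple a b c ->
  [/\ coprime a b, coprime b c, coprime a c &
      [/\ coprime 3 a, coprime 3 b & coprime 3 c]].
Proof.
move: a b c; apply: markov_ind => // [a b c | a b c | a b c _].
- by move=> [ab bc ac []]; split=> //; rewrite coprime_sym.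
- by move=> [ab bc ac []]; split=> //; rewrite coprime_sym.
move=> [ab bc ac [a3 b3 c3]] le_a _ _; split=> //; last split=> //.
- by rewrite coprime_sym coprime_dvd_subr 1?coprime_sym // mulnAC dvdn_mull.
- by rewrite coprime_sym coprime_dvd_subr 1?coprime_sym // dvdn_mull.
- by rewrite coprime_dvd_subr // -mulnA dvdn_mulr.
Qed.

(** Every Markov number is the largest entry of some triple: an entry created by
    the descent in reverse is largest when it is created. *)
Lemma markov_max a b c : markov_triple a b c ->
  exists a' b', [/\ markov_triple a' b' c, a' <= c & b' <= c]%N.
Proof.
move=> mt.
have markovC x y z : markov_triple x y z -> markov_triple y x z.
  by case=> *; split => //; lia.
have markovCA x y z : markov_triple x y z -> markov_triple x z y.
  by case=> *; split => //; lia.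
pose is_max c := exists a b, [/\ markov_triple a b c, a <= c & b <= c]%N.
suff: [/\ is_max a, is_max b & is_max c] by case.
move: a b c mt; apply: markov_ind.
- by split; exists 1%N, 1%N.
- by move=> a b c [].
- by move=> a b c [].
move=> a b c [a0 b0 c0 e] [_ maxb maxc] le_a le_b le_c; split => //.
exists b, c; split=> //; apply/markovCA/markovC.
by split => //; nia.
Qed.

(** * Wahl chains from a Markov triple *)

(** For a Markov triple (a, b, m) the two linear conditions on (n, n') form a
    system of determinant m^2, whose solution is m n = 5 a m - (a q + 3 b) and
    m n' = 4 b m + (b q - 3 a). It is integral exactly when b q = 3 a and
    a q = - 3 b modulo m, with quotients s and r. *)
Lemma wahl_of_markov (m a b q r s : int) : 0 < m ->
  a ^+ 2 + b ^+ 2 + m ^+ 2 = 3 * a * b * m ->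
  b * q = 3 * a + m * s -> a * q = - (3 * b) + m * r ->
  let n := 5 * a - r in let n' := 4 * b + s in
  n * b + n' * a = 3 * m /\
  4 * m ^+ 2 + m * q = 3 * m * (n' * a) + n * a - n' * b.
Proof.
move=> m0 mar eb ea n n'; have mn0 : m != 0 by lia.
have e1 : n * b + n' * a = 3 * m.
  apply: (mulfI mn0); rewrite /n /n'.
  have := congr1 ( *%R a) eb; have := congr1 ( *%R b) ea.
  lia.
split => //.
have ms : m * s = b * q - 3 * a by rewrite eb; ring.
have mr : m * r = a * q + 3 * b by rewrite ea; ring.
have m2 : 3 * a * b * m - a ^+ 2 - b ^+ 2 = m ^+ 2 by rewrite -mar; ring.
apply: (mulfI mn0); rewrite /n /n'.
transitivity ((4 * m + q) * (3 * a * b * m - a ^+ 2 - b ^+ 2)).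
  by rewrite m2; ring.
transitivity (3 * m * a * (4 * b * m + m * s) + a * (5 * a * m - m * r)
              - b * (4 * b * m + m * s)); last by ring.
by rewrite ms mr; ring.
Qed.

Lemma coprimez_lin (a k n x y : int) :
  coprimez a k -> k = a * x + n * y -> coprimez a n.
Proof.
move=> /coprimezP[[u v] /= uv] ek; apply/coprimezP.
by exists (u + v * x, v * y) => /=; rewrite -uv ek; ring.
Qed.

(** Take q = 3 a / b modulo m. The congruence a q = - 3 b is then automatic, for
    a^2 + b^2 = 0 modulo m, and 0 < q < m with a, b <= m gives the inequalities
    a < n and b < n'. *)
Lemma markov_wahl (m a b : nat) : (1 < m)%N -> markov_triple a b m ->
  (a <= m)%N -> (b <= m)%N -> exists q n n' : nat,
  [/\ (0 < q < m)%N, coprime q m, (a < n)%N /\ coprime a n,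
      (b < n')%N /\ coprime b n' &
      n%:Z * b + n'%:Z * a = 3 * m%:Z /\
      4 * m%:Z ^+ 2 + m%:Z * q = 3 * m%:Z * (n'%:Z * a) + n%:Z * a - n'%:Z * b].
Proof.
move=> m1 mt am bm; case: (mt) => a0 b0 _ mar.
have [ab cbm cam [c3a c3b c3m]] := markov_coprime mt.
have m0 : 0 < m%:Z by lia.
have [q [s [eb /andP[q0 qm]]]] := solve_mod (3 * a%:Z) m0 (cbm : coprimez b m).
have [r ea] : exists r, a%:Z * q = - (3 * b%:Z) + m%:Z * r.
  have /coprimezP[[u v] /= uv] : coprimez b m by [].
  (* Expand (u b + v m) (a q + 3 b), where u b + v m = 1, using
     b (a q + 3 b) = 3 (a^2 + b^2) + m a s and the Markov equation. *)
  exists (u * (9 * a%:Z * b - 3 * m%:Z + a%:Z * s) + v * (a%:Z * q + 3 * b%:Z)).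
  have marz : a%:Z ^+ 2 + b%:Z ^+ 2 + m%:Z ^+ 2 = 3 * a%:Z * b * m by lia.
  have := congr1 ( *%R (a%:Z * q + 3 * b%:Z)) uv.
  have := congr1 ( *%R (u * a)) eb; have := congr1 ( *%R (3 * u)) marz.
  lia.
(* A common divisor of m and q divides 3 b, which is prime to m. *)
have cqm : coprimez m q.
  apply: (@coprimez_lin _ (3 * b%:Z) _ r (- a%:Z)); last by lia.
  by rewrite coprimezMr !coprimezE /= ![coprime m _]coprime_sym c3m.
have q'0 : q != 0.
  by apply: contraTneq cqm => ->; rewrite coprimezE /= /coprime gcdn0; lia.
have [] := wahl_of_markov m0 _ eb ea; first by lia.
set n := 5 * a%:Z - r; set n' := 4 * b%:Z + s => e1 e2.
have an : a%:Z < n.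
  suff : r < 4 * a%:Z by rewrite /n; lia.
  rewrite -(ltr_pM2l m0).
  have : a%:Z * q < a%:Z * m by rewrite ltr_pM2l.
  have : b%:Z <= a%:Z * m by clear -bm a0; nia.
  clear -ea; lia.
have bn' : b%:Z < n'.
  suff : - s < 3 * b%:Z by rewrite /n'; lia.
  rewrite -(ltr_pM2l m0).
  have : 0 < b%:Z * q by rewrite mulr_gt0 // lt_def q'0.
  have : a%:Z <= b%:Z * m by clear -am b0; nia.
  clear -eb; lia.
(* A common divisor of a and n divides n b + n' a = 3 m; similarly for b, n'. *)
have can : coprimez a n.
  apply: (@coprimez_lin _ (3 * m%:Z) _ n' b); last by lia.
  by rewrite coprimezMr !coprimezE /= coprime_sym c3a.
have cbn' : coprimez b n'.
  apply: (@coprimez_lin _ (3 * m%:Z) _ n a); last by lia.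
  by rewrite coprimezMr !coprimezE /= coprime_sym c3b.
exists `|q|%N, `|n|%N, `|n'|%N.
rewrite coprime_sym !gez0_abs; [|lia..].
split=> //; [lia | split=> //; lia | split=> //; lia].
Qed.

Theorem theorem1p11 (m : nat) (hm : (2 <= m)%N) :
  (exists q : nat,
    [/\ (0 < q < m)%N, coprime q m &
      exists x y W0 W1 : seq nat,
        [/\ is_chain_of (m%:R / q%:R) x,
            is_chain_of (m%:R / (m%:R - q%:R)) y,
            wahl_chain W0, wahl_chain W1 &
            hj_cf ([:: 5%N] ++ x ++ [:: 2%N] ++ rev y ++ [:: 5%N]) =
            hj_cf (W0 ++ [:: 2%N] ++ W1)]])
  <->
  (exists a b c : nat,
    [/\ markov_triple a b c, (1 < a)%N, (b < c)%N & c = m]).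
Proof.
split=> [[q [qm cop [x [y [W0 [W1 [xc yc [n [a [an _ W0c]]]
    [n' [a' [an' _ W1c]]] e]]]]]]] | [a [b [c [mt _ _ ec]]]]].
  have /(dual_eq_wahl_chains hm qm cop an an' xc yc W0c W1c) [ed mar _] := e.
  set b := (n' - a')%N.
  have eb : n'%:Z - a'%:Z = b%:Z by lia.
  rewrite eb in ed mar.
  have mt : markov_triple a b m by split; lia.
  have [a1 | a_gt1] := leqP a 1; last first.
    have [mb | bm] := leqP m b; last by exists a, b, m.
    (* From a < n and b < n', 2 a b < n b + n' a = 3 m, so a and b are not
       both at least m. *)
    have am : (a < m)%N by nia.
    exists b, a, m; split=> //; last by lia.
    by split; lia.
  have ea : a = 1%N by lia.
  have [b1 | b_gt1] := leqP b 1; last first.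
    by exists b, a, m; split=> //; [split; lia | lia].
  have eb1 : b = 1%N by lia.
  have em : m = 2%N by rewrite ea eb1 in mar; nia.
  (* The triple (1, 1, 2) is replaced by its mutation (5, 1, 2). *)
  by exists 5%N, 1%N, m; rewrite em.
rewrite {}ec in mt.
have [a' [b' [mt' am bm]]] := markov_max mt.
have [q [n [n' [qm cop [an can] [bn' cbn'] [e1 e2]]]]] := markov_wahl hm mt' am bm.
case: (mt') => a0 b0 _ mar.
exists q; split=> //.
have [x xc] := hj_chain_exists qm.
have [|y yc] := @hj_chain_exists m (m - q); first by lia.
rewrite natrB in yc; last by lia.
have ann : (0 < a' < n)%N by lia.
have bnn : (0 < n' - b' < n')%N by lia.
have cop' : coprime (n' - b') n'.
  by rewrite coprime_sym coprime_dvd_subr 1?coprime_sym // ltnW.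
have [W0 W0c] := wahl_fraction_chain ann.
have [W1 W1c] := wahl_fraction_chain bnn.
exists x, y, W0, W1; split=> //; [by exists n, a' | by exists n', (n' - b')%N |].
apply/(dual_eq_wahl_chains hm qm cop ann bnn xc yc W0c W1c).
have -> : n'%:Z - (n' - b')%N%:Z = b'%:Z by lia.
by split => //; lia.
Qed.
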